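(* Let $D$ be a weighted oriented graph with vertex set $\{x_1,\dots,x_n\}$, let $K$ be a field and let $I(D)\subseteq R=K[x_1,\dots,x_n]$ be the edge ideal of $D$. Let $C_1,\dots,C_s$ be the (distinct) strong vertex covers of $D$, and let $P_i=\mathrm{rad}(I_{C_i})$. Then $P_i=(C_i)$ (the ideal generated by the variables in $C_i$) for each $i$, so that $P_i\neq P_j$ for $1\le i<j\le s$; $I_{C_1}\cap\cdots\cap I_{C_s}$ is an irredundant primary decomposition of $I(D)$; and in particular $\mathrm{Ass}(I(D))=\{P_1,\dots,P_s\}$.
   Context: A weighted oriented graph is a triplet $D=(V(D),E(D),w)$ where $V=V(D)$ is a finite set, $E=E(D)\subseteq V\times V$ is the edge set of an oriented graph (no loops, and for $x\neq y$ at most one of $(x,y),(y,x)$ is in $E$), and $w:V\to\mathbb{N}=\{1,2,\dots\}$ is the weight function. Put $V^{+}=\{x\in V: w(x)\neq 1\}$. For $x\in V$: $N_D^{+}(x)=\{y:(x,y)\in E\}$, $N_D^{-}(x)=\{y:(y,x)\in E\}$, $N_D(x)=N_D^+(x)\cup N_D^-(x)$. A source is a vertex $x$ with $N_D(x)=N_D^+(x)$. Standing assumption: if $x$ is a source of $D$, then $w(x)=1$. Vertices are identified with the variables of $R=K[x_1,\dots,x_n]$, $K$ a field. The edge ideal is $I(D)=(x_ix_j^{w(x_j)} : (x_i,x_j)\in E)\subseteq R$. $\mathrm{Ass}(I(D))$ denotes the set of associated primes of $R/I(D)$. A vertex cover of $D$ is a subset $C\subseteq V$ such that for every $(x,y)\in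 E$, $x\in C$ or $y\in C$. For a vertex cover $C$, with $C^c=V\setminus C$, define $L_1(C)=\{x\in C: N_D^{+}(x)\cap C^c\neq\emptyset\}$, $L_2(C)=\{x\in C: x\notin L_1(C)\text{ and }N_D^{-}(x)\cap C^c\neq\emptyset\}$, $L_3(C)=C\setminus(L_1(C)\cup L_2(C))$. A vertex cover $C$ is strong if for each $x\in L_3(C)$ there is $(y,x)\in E$ such that $y\in L_2(C)\cup L_3(C)$ and $y\in V^{+}$. The irreducible ideal associated to a vertex cover $C$ is $I_C=\bigl(L_1(C)\cup\{x_j^{w(x_j)} : x_j\in L_2(C)\cup L_3(C)\}\bigr)\subseteq R$. *)

(* Defs.v *)
(* MathComp, with mathcomp-classical sets for ideals and multinomials for K[x_1, ..., x_n]. *)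
From mathcomp Require Export all_boot all_order all_algebra.
From mathcomp Require Export boolp classical_sets.
From mathcomp Require Export mpoly.

Set Implicit Arguments.
Unset Strict Implicit.
Unset Printing Implicit Defensive.

Import GRing.Theory.

(* Vertex x_(i+1) is i : 'I_n. *)
Record woGraph (n : nat) := WOGraph {
  arc : rel 'I_n;
  weight : 'I_n -> nat;
  arc_irrefl : irreflexive arc;
  arc_asym : forall x y, arc x y -> ~~ arc y x;
  weight_gt0 : forall x, 0 < weight x
}.

Section WeightedOrientedGraphs.
Variables (n : nat) (D : woGraph n).
Implicit Types (x y : 'I_n) (C : {set 'I_n}).

Definition Vplus : {set 'I_n} := [set x | weight D x != 1]%SET.

Definition outNbr x : {set 'I_n} := [set y | arc D x y]%SET.
Definition inNbr x : {set 'I_n} := [set y | arc D y x]%SET.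
Definition nbr x : {set 'I_n} := outNbr x :|: inNbr x.

Definition source x : bool := nbr x == outNbr x.

Definition vertex_cover C : bool :=
  [forall x, forall y, arc D x y ==> (x \in C) || (y \in C)].

Definition L1 C : {set 'I_n} := [set x in C | outNbr x :&: ~: C != finset.set0]%SET.
Definition L2 C : {set 'I_n} :=
  [set x in C | (x \notin L1 C) && (inNbr x :&: ~: C != finset.set0)]%SET.
Definition L3 C : {set 'I_n} := C :\: (L1 C :|: L2 C).

Definition strong_vertex_cover C : bool :=
  vertex_cover C &&
  [forall x in L3 C,
     exists y, [&& arc D y x, y \in L2 C :|: L3 C & y \in Vplus]].

End WeightedOrientedGraphs.

Local Open Scope ring_scope.
Local Open Scope classical_set_scope.

(* The ideals of ring_quotient are proper and decidable by definition; here an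
   ideal is an arbitrary subset, possibly the whole ring. *)
Section Ideals.
Variable R : comNzRingType.
Implicit Types (I P Q G : set R).

Definition is_ideal I : Prop :=
  [/\ I 0, forall f g, I f -> I g -> I (f + g) & forall a f, I f -> I (a * f)].

Definition ideal_gen G : set R := smallest is_ideal G.

Definition radical I : set R := [set f | exists k : nat, I (f ^+ k)].

Definition prime_ideal P : Prop :=
  [/\ is_ideal P, ~ P 1 & forall f g, P (f * g) -> P f \/ P g].

Definition primary_ideal Q : Prop :=
  [/\ is_ideal Q, ~ Q 1 & forall f g, Q (f * g) -> Q f \/ radical Q g].

Definition irredundant_primary_decomposition (s : nat) I
    (Q : 'I_s -> set R) : Prop :=
  [/\ forall i, primary_ideal (Q i),
      I = \bigcap_(i in [set: 'I_s]) Q i,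
      forall i j, i != j -> radical (Q i) <> radical (Q j)
    & forall i, I <> \bigcap_(j in [set j | j != i]) Q j].

(* [set g | I (g * f)] is the annihilator of the class of f in R/I. *)
Definition Ass I : set (set R) :=
  [set P | prime_ideal P /\ exists f, P = [set g | I (g * f)]].

End Ideals.

Section IdealsOfGraphs.
Variables (K : fieldType) (n : nat) (D : woGraph n).
Implicit Types (x y : 'I_n) (C : {set 'I_n}).

Definition edge_ideal : set {mpoly K[n]} :=
  ideal_gen [set f | exists x y, arc D x y /\ f = 'X_x * 'X_y ^+ weight D y].

Definition var_ideal C : set {mpoly K[n]} :=
  ideal_gen [set f | exists2 x, x \in C & f = 'X_x].

Definition cover_ideal C : set {mpoly K[n]} :=
  ideal_gen ([set f | exists2 x, x \in L1 D C & f = 'X_x] `|`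
             [set f | exists2 x, x \in L2 D C :|: L3 D C
                    & f = 'X_x ^+ weight D x]).

End IdealsOfGraphs.

Arguments edge_ideal K {n} D.
Arguments var_ideal K {n} C.
Arguments cover_ideal K {n} D C.

(* Main.v *)
(** All ideals involved are monomial, so membership is decided exponent by
    exponent.  A monomial [m] outside [I(D)] lies outside [I_C] for the cover
    [C = {x | m x < w x}]; a minimal cover [C] with [m] outside [I_C] is strong,
    since a vertex of [L3 C] violating strength could be removed from [C].  For
    irredundance, let [C] be strong and let [m] be the monomial with exponent one
    less than that of the generator of [I_C] on each [x] in [C], and large outside
    [C].  If [m] is outside [I_C'] for a cover [C'], then [C'] is contained in [C];
    any vertex of [C] missing from [C'] lies in [L3 C], and the heavy in-neighbour
    provided by strength is in [L1 C'] and has positive exponent in [m], which is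
    absurd.  The same [m] satisfies [(I(D) : m) = (C)]. *)
Require Import Defs.

Set Implicit Arguments.
Unset Strict Implicit.
Unset Printing Implicit Defensive.

Import GRing.Theory.
Local Open Scope ring_scope.
Local Open Scope classical_set_scope.

(** * Associated primes of an ideal with a primary decomposition *)

Section IdealTheory.
Variable R : comNzRingType.
Implicit Types (I P Q : set R).

Lemma is_ideal_mulr I a f : is_ideal I -> I f -> I (f * a).
Proof. by case=> _ _ IM If; rewrite mulrC; apply: IM. Qed.

Lemma is_idealB I f g : is_ideal I -> I f -> I g -> I (f - g).
Proof. by case=> _ ID IM If Ig; apply: ID => //; rewrite -mulN1r; apply: IM. Qed.

Lemma prime_idealX P f k : prime_ideal P -> P (f ^+ k) -> P f.
Proof.
case=> _ P1 PM; elim: k => [|k IHk]; first by rewrite expr0 => /P1.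
by rewrite exprS => /PM[].
Qed.

Lemma prime_ideal_prod P (T : finType) (g : T -> R) :
  prime_ideal P -> P (\prod_i g i) -> exists i, P (g i).
Proof.
case=> _ P1 PM; elim/big_ind: _ => // [x y IHx IHy /PM[]|i _ Pgi].
- exact: IHx.
- exact: IHy.
- by exists i.
Qed.

(** If each [Q i] contained [g i * f] for some [g i] outside [P], the product of the [g i] would
    annihilate [f] modulo [I] and so lie in the prime [P]. Hence some colon [(Q i : f)] lies in [P].
    Then [f] is not in [Q i], so primariness puts [P] inside the radical; conversely [Q i] lies in
    the prime [P]. *)
Lemma Ass_primary_decomposition (T : finType) I (Q : T -> set R) P :
  (forall i, primary_ideal (Q i)) -> I = \bigcap_(i in [set: T]) Q i ->
  Ass I P -> exists i, P = radical (Q i).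
Proof.
move=> Qprim IE [Pprime [f PE]].
have [i Pi] : exists i, [set g | Q i (g * f)] `<=` P.
  apply: contrapT => /forallNP nP.
  have {}nP i : exists g, Q i (g * f) /\ ~ P g.
    by apply: contrapT => /forallNP nPi; apply: (nP i) => g Qgf; apply: contrapT
      => nPg; apply: (nPi g).
  have [g gP] := boolp.choice nP.
  have [] : exists i, P (g i); last by move=> i; case: (gP i).
  apply: prime_ideal_prod => //.
  rewrite PE IE /= => i _; rewrite (bigD1 i) //= mulrAC.
  by apply: is_ideal_mulr; [case: (Qprim i) | case: (gP i)].
have [Qi _ QM] := Qprim i; have [_ P1 _] := Pprime.
exists i; rewrite eqEsubset; split=> g.
- rewrite {1}PE IE /= => /(_ i Logic.I); rewrite mulrC => /QM[] // Qf.
  by case: P1; apply: Pi; rewrite /= mul1r.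
- case=> k Qgk; apply: (@prime_idealX _ _ k) => //; apply: Pi => /=.
  exact: is_ideal_mulr.
Qed.

End IdealTheory.

(** * Monomial ideals, in particular those generated by powers of variables *)

Section MonomialIdeals.
Variables (n : nat) (K : fieldType).
Implicit Types (S : pred 'X_{1..n}) (f g h : {mpoly K[n]}) (m u : 'X_{1..n}).
Implicit Types (C : {set 'I_n}) (a : 'I_n -> nat).

(** [S] is an arbitrary predicate, so that complements of monomial ideals, which are only subspaces,
    are covered too. *)
Definition mono_span S : set {mpoly K[n]} := [set f | {subset msupp f <= S}].

Lemma mono_spanX S m : mono_span S 'X_[m] <-> S m.
Proof.
rewrite /mono_span /= msuppX; split=> [|Sm u]; first by apply; rewrite inE.
by rewrite inE => /eqP->.
Qed.

Lemma mono_spanM S1 S2 S f g :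
  (forall u v, S1 u -> S2 v -> S (u + v)%MM) ->
  mono_span S1 f -> mono_span S2 g -> mono_span S (f * g).
Proof.
move=> SM Sf Sg m /msuppM_le /allpairsP[[u v] /= [/Sf Su /Sg Sv ->]].
exact: SM.
Qed.

Lemma mono_spanMX S f m :
  mono_span S (f * 'X_[m]) <-> mono_span [pred u | S (m + u)%MM] f.
Proof.
rewrite /mono_span /=; split=> Sf u; last first.
  by rewrite (perm_mem (msuppMX _ _)) => /mapP[v vf ->]; apply: Sf.
by move=> uf; apply: Sf; rewrite (perm_mem (msuppMX _ _)) map_f.
Qed.

Lemma mono_span_split S f :
  exists f1 f2, [/\ f = f1 + f2, mono_span S f1 & mono_span (predC S) f2].
Proof.
have spanP (S' : pred 'X_{1..n}) :
    mono_span S' (\sum_(m <- msupp f | S' m) f@_m *: 'X_[m]).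
  move=> u /msupp_sum_le /flattenP[s /mapP[m]]; rewrite mem_filter.
  by move=> /andP[S'm _] -> /msuppZ_le; rewrite msuppX inE => /eqP->.
exists (\sum_(m <- msupp f | S m) f@_m *: 'X_[m]).
exists (\sum_(m <- msupp f | predC S m) f@_m *: 'X_[m]).
by split=> //; rewrite {1}[f]mpolyE (bigID S).
Qed.

Definition upclosed S := forall m u, S m -> S (m + u)%MM.

Lemma mono_span_ideal S : upclosed S -> is_ideal (mono_span S).
Proof.
move=> Sup; split=> [m|f g Sf Sg m /msuppD_le|h f Sf].
- by rewrite msupp0.
- by rewrite mem_cat => /orP[/Sf|/Sg].
- apply: (@mono_spanM xpredT S) => // u v _ Sv.
  by rewrite mpoly.addmC; apply: Sup.
Qed.

Lemma ideal_gen_mono_span (G : set {mpoly K[n]}) S : upclosed S ->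
  (forall f, G f -> exists2 m, f = 'X_[m] & S m) ->
  (forall m, S m -> exists2 u, G 'X_[u] & (u <= m)%MM) ->
  ideal_gen G = mono_span S.
Proof.
move=> Sup GS SG; rewrite eqEsubset; split=> f.
  apply; split; first exact: mono_span_ideal.
  by move=> g /GS[m -> Sm]; apply/mono_spanX.
move=> Sf J [[J0 JD JM] GJ]; rewrite [f]mpolyE.
rewrite big_seq; elim/big_ind: _ => // m /Sf /SG[u Gu /submK <-].
by rewrite mpolyXD scalerAl; apply/JM/GJ.
Qed.

(** Common form of both families: [a] constantly one gives the ideal of the variables in [C], and
    [cover_exp] below gives [I_C]. *)
Definition powers_in C a : pred 'X_{1..n} :=
  fun m => [exists x in C, (a x <= m x)%N].

Definition power_ideal C a := mono_span (powers_in C a).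

Lemma powers_in_upclosed C a : upclosed (powers_in C a).
Proof.
move=> m u /exists_inP[x xC am]; apply/exists_inP; exists x => //.
by rewrite mnmDE (leq_trans am) ?leq_addr.
Qed.

Lemma power_idealP C a : is_ideal (power_ideal C a).
Proof. exact/mono_span_ideal/powers_in_upclosed. Qed.

Lemma ideal_gen_powers C a (G : set {mpoly K[n]}) :
  (forall f, G f <-> exists2 x, x \in C & f = 'X_x ^+ a x) ->
  ideal_gen G = power_ideal C a.
Proof.
move=> GE; apply: ideal_gen_mono_span; first exact: powers_in_upclosed.
  move=> f /GE[x xC ->]; exists (U_(x) *+ a x)%MM; first by rewrite mpolyXn.
  by apply/exists_inP; exists x => //; rewrite mulmnE mnm1E eqxx mul1n.
move=> m /exists_inP[x xC am]; exists (U_(x) *+ a x)%MM.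
  by apply/GE; exists x => //; rewrite mpolyXn.
apply/mnm_lepP => y; rewrite mulmnE mnm1E.
by case: eqVneq => [<-|_]; rewrite ?mul1n.
Qed.

Lemma var_power_ideal C : var_ideal K C = power_ideal C (fun=> 1%N).
Proof. by apply: ideal_gen_powers => f; split=> -[x xC ->]; exists x. Qed.

Lemma power_ideal_sub_var C a :
  (forall x, 0 < a x)%N -> power_ideal C a `<=` var_ideal K C.
Proof.
move=> a0 f Sf; rewrite var_power_ideal => m /Sf /exists_inP[x xC am].
by apply/exists_inP; exists x => //; apply: leq_trans am.
Qed.

(* Multiplying a monomial by one in the variables outside [C] does not change
   whether it lies in [powers_in C a], so no cancellation in [f * h] can help. *)
Lemma power_ideal_regular C a f h :
  mono_span (predC (powers_in C (fun=> 1%N))) h -> h != 0 ->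
  power_ideal C a (f * h) -> power_ideal C a f.
Proof.
move=> hC h0.
have [f1 [f2 [-> f1Q f2Q]]] := mono_span_split (powers_in C a) f.
rewrite mulrDl => fhQ.
have f2hQ : power_ideal C a (f2 * h).
  rewrite -[f2 * h](addKr (f1 * h)) addrC.
  have Qid := power_idealP C a.
  exact: is_idealB Qid fhQ (is_ideal_mulr _ Qid f1Q).
have f2hNQ : mono_span (predC (powers_in C a)) (f2 * h).
  apply: mono_spanM f2Q hC => u v /= uQ vC; apply: contra uQ.
  case/exists_inP=> x xC; rewrite mnmDE => auv; apply/exists_inP; exists x => //.
  suff v0 : v x = 0%N by rewrite v0 addn0 in auv.
  apply/eqP; rewrite -leqn0 leqNgt; apply: contra vC => v0.
  by apply/exists_inP; exists x.
suff /eqP : f2 * h = 0.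
  rewrite mulf_eq0 (negbTE h0) orbF => /eqP->; rewrite addr0; exact: f1Q.
apply: msuppnil0; case E: (msupp (f2 * h)) => [//|m s].
have mS : m \in msupp (f2 * h) by rewrite E mem_head.
by have /negP := f2hNQ m mS; case; apply: f2hQ.
Qed.

Lemma var_idealX C f k : var_ideal K C f ->
  mono_span (fun m => k <= \sum_(x in C) m x)%N (f ^+ k).
Proof.
rewrite var_power_ideal => fC; elim: k => [m //|k IHk].
rewrite exprS; apply: mono_spanM fC IHk => u v /exists_inP[x xC ux] kv.
rewrite (eq_bigr (fun x => u x + v x)%N) => [|y _]; last by rewrite mnmDE.
by rewrite big_split -add1n leq_add // (bigD1 x) //= ltn_addr.
Qed.

Lemma var_idealX_power_ideal C a f : var_ideal K C f ->
  power_ideal C a (f ^+ (\sum_(x in C) a x).+1).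
Proof.
(* Pigeonhole: if every exponent on [C] stays below its bound [a x], the degree in the variables of
   [C] is at most the sum of the bounds. *)
move=> /var_idealX fC m /fC; apply: contraLR => mQ.
rewrite unfold_in -ltnNge ltnS; apply: leq_sum => x xC.
by apply: ltnW; rewrite ltnNge; apply: contra mQ => am; apply/exists_inP; exists x.
Qed.

Lemma var_ideal_split C g : ~ var_ideal K C g -> exists p h,
  [/\ g = p + h, var_ideal K C p, h != 0
    & mono_span (predC (powers_in C (fun=> 1%N))) h].
Proof.
rewrite var_power_ideal => gC.
have [p [h [gE pC hC]]] := mono_span_split (powers_in C (fun=> 1%N)) g.
exists p, h; split=> //; apply/eqP => h0; apply: gC.
rewrite gE h0 addr0; exact: pC.
Qed.

Lemma power_ideal_N1 C a : (forall x, 0 < a x)%N -> ~ power_ideal C a 1.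
Proof.
move=> a0; rewrite -mpolyX0 => /mono_spanX /exists_inP[x _].
by rewrite mnm0E leqNgt a0.
Qed.

(** Split [g = p + h] with [p] in [(C)] and [h] free of the variables of [C]. A high power of [p]
    lies in the ideal, hence so does [f * h ^+ N], and a nonzero polynomial free of these variables
    is regular modulo the ideal. *)
Lemma power_ideal_cancel C a f g :
  power_ideal C a (f * g) -> power_ideal C a f \/ var_ideal K C g.
Proof.
move=> fgQ; have [gC|] := pselect (var_ideal K C g); first by right.
case/var_ideal_split=> p [h [gE pC h0 hC]]; left.
set N := (\sum_(x in C) a x).+1.
(* [h ^ N] and [(- p) ^ N] are congruent modulo [g = h + p]. *)
have hN : power_ideal C a (f * h ^+ N).
  have [_ QD QM] := power_idealP C a.
  rewrite -(subrK ((- p) ^+ N) (h ^+ N)) subrXX opprK (addrC h) -gE mulrDr mulrA.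
  apply: QD; first exact: is_ideal_mulr (power_idealP _ _) fgQ.
  by rewrite exprNn; do 2!apply: (QM); apply: var_idealX_power_ideal.
apply: power_ideal_regular hN; last by rewrite expf_neq0.
elim: N => [|N IHN].
  move=> m; rewrite expr0 msupp1 inE => /eqP->.
  by rewrite unfold_in; apply/exists_inPn => x _; rewrite mnm0E.
rewrite exprS; apply: mono_spanM hC IHN => u v /exists_inPn uC /exists_inPn vC.
apply/exists_inPn => x xC; rewrite mnmDE addn_gt0 negb_or.
by rewrite uC ?vC.
Qed.

(** When all exponents are one, the cancellation property is primality itself. *)
Lemma var_ideal_prime C : prime_ideal (var_ideal K C).
Proof.
split=> [||f g]; rewrite var_power_ideal; first exact: power_idealP.
  exact: power_ideal_N1.
by move/power_ideal_cancel; rewrite var_power_ideal.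
Qed.

Lemma radical_power_ideal C a : (forall x, 0 < a x)%N ->
  radical (power_ideal C a) = var_ideal K C.
Proof.
move=> a0; rewrite eqEsubset; split=> f; last first.
  by move=> fC; eexists; apply: var_idealX_power_ideal.
case=> k /(power_ideal_sub_var a0); exact: prime_idealX (var_ideal_prime C).
Qed.

Lemma power_ideal_primary C a :
  (forall x, 0 < a x)%N -> primary_ideal (power_ideal C a).
Proof.
move=> a0; split; [exact: power_idealP | exact: power_ideal_N1 |].
by move=> f g; rewrite radical_power_ideal //; apply: power_ideal_cancel.
Qed.

Lemma var_ideal_inj : injective (@var_ideal K n).
Proof.
have sub C1 C2 : var_ideal K C1 = var_ideal K C2 -> C1 \subset C2.
  rewrite !var_power_ideal => E; apply/fintype.subsetP => x xC.
  have : power_ideal C1 (fun=> 1%N) 'X_x.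
    by apply/mono_spanX/exists_inP; exists x => //; rewrite mnm1E eqxx.
  rewrite E => /mono_spanX /exists_inP[y yC]; rewrite mnm1E lt0b.
  by move/eqP->.
by move=> C1 C2 E; apply/eqP; rewrite finset.eqEsubset !sub.
Qed.

(** Each exponent of [m] on [C] is one short of its bound, so [m + u] reaches a bound exactly when
    [u] involves a variable of [C]. *)
Lemma colon_corner C a m : (forall x, 0 < a x)%N ->
  {in C, forall x, m x = (a x).-1} ->
  [set g | power_ideal C a (g * 'X_[m])] = var_ideal K C.
Proof.
move=> a0 mE; rewrite var_power_ideal eqEsubset.
have E u : powers_in C a (m + u)%MM = powers_in C (fun=> 1%N) u.
  apply: eq_existsb => x; case: (boolP (x \in C)) => //= xC.
  by rewrite mnmDE mE // -{1}(prednK (a0 x)) -addn1 leq_add2l.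
split=> g => [/mono_spanMX gS u /gS|gS].
  by move=> Su; change (powers_in C (fun=> 1%N) u); rewrite -E.
by apply/mono_spanMX => u /gS ?; change (powers_in C a (m + u)%MM); rewrite E.
Qed.

End MonomialIdeals.

(** * Strong vertex covers and exponents of monomials *)

Section Covers.
Variables (n : nat) (D : woGraph n).
Implicit Types (x y : 'I_n) (C : {set 'I_n}) (m : 'X_{1..n}).

(** Exponents of the monomials in [I(D)]; without loops, divisibility by an edge generator is tested
    separately at its two ends. *)
Definition edge_monomials : pred 'X_{1..n} :=
  fun m => [exists x, exists y, [&& arc D x y, 0 < m x & weight D y <= m y]%N].

Definition cover_exp C x : nat := if x \in L1 D C then 1%N else weight D x.

Lemma cover_exp_gt0 C x : (0 < cover_exp C x)%N.
Proof. by rewrite /cover_exp; case: ifP => // _; apply: weight_gt0. Qed.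

Lemma L1P C x :
  reflect (x \in C /\ exists2 y, arc D x y & y \notin C) (x \in L1 D C).
Proof.
rewrite inE; apply: (iffP andP) => -[xC].
  by move=> /finset.set0Pn[y]; rewrite !inE => /andP[xy yC]; split=> //; exists y.
by case=> y xy yC; split=> //; apply/finset.set0Pn; exists y; rewrite !inE xy.
Qed.

Lemma L2U3 C : L2 D C :|: L3 D C = C :\: L1 D C.
Proof.
apply/setP => x; rewrite !inE.
by case: (x \in C); case: (_ != _); case: (_ != _).
Qed.

Lemma L3P C x : reflect
  [/\ x \in C, forall y, arc D x y -> y \in C & forall y, arc D y x -> y \in C]
  (x \in L3 D C).
Proof.
rewrite finset.in_setD finset.in_setU negb_or; apply: (iffP andP).
  case=> /andP[xL1 xL2] xC; split=> // y e; apply: contraT => yC.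
    by case/L1P: xL1; split=> //; exists y.
  move: xL2; rewrite inE xC xL1 /= => /finset.set0Pn[].
  by exists y; rewrite !inE e yC.
case=> xC xout xin; split=> //; apply/andP; split.
  by apply/L1P => -[_ [y /xout->]].
rewrite inE xC; apply/nandP; right; apply/nandP; right.
by rewrite negbK; apply/eqP/setP => y; rewrite !inE; apply/andP => -[/xin->].
Qed.

Lemma vertex_coverP C :
  reflect (forall x y, arc D x y -> x \in C \/ y \in C) (vertex_cover D C).
Proof.
apply: (iffP forallP) => [H x y xy|H x].
  by move/forallP/(_ y)/implyP/(_ xy)/orP: (H x).
by apply/forallP => y; apply/implyP => /H /orP.
Qed.

(** For the edge [(x, y)] dividing [m]: if [y] is in [C], its generator has exponent at most
    [weight D y]; otherwise [x] is in [L1 D C] and has exponent one. *)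
Lemma edge_monomials_cover C m : vertex_cover D C ->
  edge_monomials m -> powers_in C (cover_exp C) m.
Proof.
move=> /vertex_coverP Ccov /existsP[x /existsP[y /and3P[xy mx my]]].
apply/exists_inP; have [yC|yC] := boolP (y \in C).
  exists y => //; rewrite /cover_exp; case: ifP => // _.
  exact: leq_trans (weight_gt0 D y) my.
have [xC|] := Ccov _ _ xy; last by rewrite (negbTE yC).
exists x => //; suff xL1 : x \in L1 D C by rewrite /cover_exp xL1.
by apply/L1P; split=> //; exists y.
Qed.

Definition avoiding_cover m C :=
  vertex_cover D C && ~~ powers_in C (cover_exp C) m.

Lemma avoiding_coverP m C : reflect
  [/\ vertex_cover D C, {in C, forall x, m x < weight D x}%N
    & {in L1 D C, forall x, m x = 0%N}]
  (avoiding_cover m C).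
Proof.
apply: (iffP andP) => [[Ccov /exists_inPn mC]|[Ccov mC mL1]].
  split=> // x xC; last first.
    have /L1P[xC' _] := xC.
    by have := mC x xC'; rewrite /cover_exp xC -leqNgt leqn0 => /eqP.
  have := mC x xC; rewrite -ltnNge /cover_exp; case: ifP => // _ mx.
  exact: leq_trans mx (weight_gt0 D x).
split=> //; apply/exists_inPn => x xC; rewrite -ltnNge /cover_exp.
by case: ifP => [/mL1->|_] //; apply: mC.
Qed.

Lemma avoiding_cover_light m : ~~ edge_monomials m ->
  avoiding_cover m [set x | (m x < weight D x)%N]%SET.
Proof.
move=> mE; have edge x y : arc D x y -> (0 < m x)%N -> (m y < weight D y)%N.
  move=> xy mx; rewrite ltnNge; apply: contra mE => my.
  by apply/existsP; exists x; apply/existsP; exists y; apply/and3P.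
apply/avoiding_coverP; split=> [|x|x].
- apply/vertex_coverP => x y xy; rewrite !inE.
  have [/(edge _ _ xy)|] := ltnP 0 (m x); first by right.
  by rewrite leqn0 => /eqP->; left; apply: weight_gt0.
- by rewrite inE.
(* An out-neighbour [y] outside the cover has [m y] at least its weight, so a positive [m x] would
   put [m] in [I(D)]. *)
- case/L1P=> _ [y xy]; rewrite inE => my; apply/eqP; rewrite -leqn0 leqNgt.
  by apply: contra my; apply: edge.
Qed.

Lemma minimal_avoiding_cover_strong m C :
  minset (avoiding_cover m) C -> strong_vertex_cover D C.
Proof.
case/minsetP=> /avoiding_coverP[Ccov mC mL1] Cmin.
apply/andP; split=> //; apply/forall_inP => x /L3P[xC xout xin].
apply: contraT => /existsPn heavy.
(* If [C :\ x] is still an avoiding cover, minimality forces [C :\ x = C], which is absurd. *)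
have : x \in C :\ x; last by rewrite !inE eqxx.
rewrite (Cmin (C :\ x)) ?subD1set //.
have neC y : arc D x y || arc D y x -> y \in C :\ x.
  move=> e; rewrite !inE; apply/andP; split.
    by apply: contraTN e => /eqP->; rewrite arc_irrefl.
  by case/orP: e => [/xout|/xin].
apply/avoiding_coverP; split=> [|y /finset.setD1P[_ /mC] //|y].
  apply/vertex_coverP => y z yz.
  have [yx|yx] := eqVneq y x; first by right; rewrite neC // -yx yz.
  have [zx|zx] := eqVneq z x; first by left; rewrite neC // -zx yz orbT.
  by rewrite !finset.in_setD1 yx zx; apply/vertex_coverP.
case/L1P => /finset.setD1P[_ yC] [z yz zC].
have [/mL1 //|yL1] := boolP (y \in L1 D C).
(* As [y] is not in [L1 C], its out-neighbour [z] outside [C :\ x] is [x]. *)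
have zx : z = x.
  apply/eqP; apply: contraR zC => zx; rewrite finset.in_setD1 zx.
  by apply: contraR yL1 => zC; apply/L1P; split=> //; exists z.
(* Since [x] violates strength, its in-neighbour [y] has weight one, and [m y < 1]. *)
have := heavy y; rewrite -zx yz L2U3 finset.in_setD yL1 yC inE /= negbK => /eqP wy.
by have := mC y yC; rewrite wy ltnS leqn0 => /eqP.
Qed.

Lemma strong_cover_avoiding m : ~~ edge_monomials m ->
  exists C, strong_vertex_cover D C && ~~ powers_in C (cover_exp C) m.
Proof.
move=> /avoiding_cover_light mav; have [C Cmin _] := minset_exists mav.
exists C; rewrite (minimal_avoiding_cover_strong Cmin).
by case/minsetP: Cmin => /andP[].
Qed.

Lemma edge_monomialsP m : reflect
  (forall C, strong_vertex_cover D C -> powers_in C (cover_exp C) m)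
  (edge_monomials m).
Proof.
apply: (iffP idP) => [mE C /andP[Ccov _]|H]; first exact: edge_monomials_cover.
apply: contraT => /strong_cover_avoiding[C /andP[/H->]] //.
Qed.

(** The exponent [weight D x] outside [C] keeps [x] out of every cover whose ideal misses this
    monomial. *)
Definition corner C : 'X_{1..n} :=
  [multinom if x \in C then (cover_exp C x).-1 else weight D x | x < n].

Lemma corner_in C x : x \in C -> corner C x = (cover_exp C x).-1.
Proof. by rewrite mnmE => ->. Qed.

Lemma corner_avoid C : ~~ powers_in C (cover_exp C) (corner C).
Proof.
apply/exists_inPn => x xC; rewrite corner_in // -ltnNge prednK //.
exact: cover_exp_gt0.
Qed.

Lemma corner_other C C' : strong_vertex_cover D C -> vertex_cover D C' ->
  C' != C -> powers_in C' (cover_exp C') (corner C).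
Proof.
case/andP=> _ /forall_inP Cstrong C'cov; apply: contraR => C'av.
have /avoiding_coverP[_ cC' cL1] : avoiding_cover (corner C) C'.
  by rewrite /avoiding_cover C'cov.
have C'C : C' \subset C.
  by apply/fintype.subsetP => x /cC'; rewrite mnmE; case: ifP => //; rewrite ltnn.
rewrite finset.eqEsubset C'C /=; apply/fintype.subsetP => x xC; apply: contraT => xC'.
(* As [C'] covers the edges at [x] without containing [x], all neighbours of [x] are in [C'], hence
   in [C]. *)
have /Cstrong /existsP[y /and3P[yx]] : x \in L3 D C.
  by apply/L3P; split=> // y /(vertex_coverP _ C'cov)[]; rewrite ?(negbTE xC') //;
    apply: (fintype.subsetP C'C).
rewrite L2U3 inE => /andP[yL1 yC]; rewrite inE => wy.
have /cL1 : y \in L1 D C'.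
  apply/L1P; split; last by exists x.
  by case: (vertex_coverP _ C'cov _ _ yx); rewrite ?(negbTE xC').
(* The exponent of the corner at [y] is [weight D y - 1], positive because [y] is heavy, whereas
   membership in [L1 D C'] makes it zero. *)
rewrite corner_in // /cover_exp (negbTE yL1).
by have := weight_gt0 D y; case: (weight D y) wy => [|[|w]].
Qed.

End Covers.

(** * The edge ideal as an intersection of cover ideals, and its colons *)

Section GraphIdeals.
Variables (K : fieldType) (n : nat) (D : woGraph n).
Implicit Types (C : {set 'I_n}).

Lemma cover_power_ideal C : cover_ideal K D C = power_ideal C (cover_exp D C).
Proof.
apply: ideal_gen_powers => f; rewrite L2U3; split=> [[]|] [x].
- by move=> xL1 ->; exists x; rewrite ?/cover_exp ?xL1 //; case/L1P: xL1.
- by rewrite finset.in_setD => /andP[/negbTE xL1 xC] ->; exists x; rewrite /cover_exp ?xL1.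
- move=> xC ->; rewrite /cover_exp; case: ifP => xL1; [left|right]; exists x => //.
  by rewrite finset.in_setD xL1.
Qed.

Lemma edge_mono_span : edge_ideal K D = mono_span (edge_monomials D).
Proof.
apply: ideal_gen_mono_span.
- move=> m u /existsP[x /existsP[y /and3P[xy mx my]]].
  apply/existsP; exists x; apply/existsP; exists y; rewrite xy !mnmDE.
  by rewrite ltn_addr // (leq_trans my) ?leq_addr.
- move=> _ [x [y [xy ->]]]; exists (U_(x) + U_(y) *+ weight D y)%MM.
    by rewrite mpolyXD mpolyXn.
  apply/existsP; exists x; apply/existsP; exists y; rewrite xy !mnmDE !mulmnE.
  by rewrite !mnm1E !eqxx mul1n leq_addl.
- move=> m /existsP[x /existsP[y /and3P[xy mx my]]].
  exists (U_(x) + U_(y) *+ weight D y)%MM.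
    by exists x, y; rewrite mpolyXD mpolyXn.
  apply/mnm_lepP => z; rewrite mnmDE mulmnE !mnm1E.
  case: (eqVneq x z) => [<-|_]; last by case: eqVneq => [<-|_]; rewrite ?mul1n.
  by case: eqVneq xy => [->|_ _]; rewrite ?arc_irrefl // addn0.
Qed.

Lemma edge_idealE : edge_ideal K D =
  \bigcap_(C in [set C | strong_vertex_cover D C]) cover_ideal K D C.
Proof.
rewrite edge_mono_span eqEsubset; split=> f fI.
  move=> C Cs; rewrite cover_power_ideal => m /fI /edge_monomialsP; exact.
move=> m mf; apply/edge_monomialsP => C Cs.
by have := fI C Cs; rewrite cover_power_ideal; apply.
Qed.

Lemma corner_cover_ideal C : ~ cover_ideal K D C 'X_[corner D C].
Proof.
rewrite cover_power_ideal => /mono_spanX; apply/negP; exact: corner_avoid.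
Qed.

Lemma corner_cover_ideal_other C C' :
  strong_vertex_cover D C -> strong_vertex_cover D C' -> C' <> C ->
  cover_ideal K D C' 'X_[corner D C].
Proof.
move=> Cs /andP[C'cov _] /eqP CC'; rewrite cover_power_ideal.
by apply/mono_spanX/corner_other.
Qed.

(** Every other component contains the corner monomial and contributes the whole ring to the colon;
    only the component of [C] remains. *)
Lemma edge_ideal_colon_corner C : strong_vertex_cover D C ->
  [set g | edge_ideal K D (g * 'X_[corner D C])] = var_ideal K C.
Proof.
move=> Cs.
rewrite -(@colon_corner _ _ C (cover_exp D C) (corner D C)); first last.
- by move=> x; apply: corner_in.
- exact: cover_exp_gt0.
rewrite -cover_power_ideal edge_idealE eqEsubset; split=> g /=; first exact.
move=> gC C' C's; have [->//|/eqP CC'] := eqVneq C' C.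
rewrite [cover_ideal K D C']cover_power_ideal.
have [_ _ IM] := power_idealP K C' (cover_exp D C'); apply: IM.
by rewrite -cover_power_ideal; apply: corner_cover_ideal_other.
Qed.

Lemma radical_cover_ideal C : radical (cover_ideal K D C) = var_ideal K C.
Proof. by rewrite cover_power_ideal radical_power_ideal //; apply: cover_exp_gt0. Qed.

End GraphIdeals.

Theorem mainTheorem4 (n : nat) (D : woGraph n) (K : fieldType)
    (source_weight : forall x : 'I_n, source D x -> weight D x = 1%N)
    (s : nat) (C : 'I_s -> {set 'I_n})
    (C_inj : injective C)
    (C_enum : forall A : {set 'I_n},
       strong_vertex_cover D A <-> exists i : 'I_s, C i = A) :
  let P := fun i : 'I_s => radical (cover_ideal K D (C i)) in
  [/\ forall i : 'I_s, P i = var_ideal K (C i),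
      forall i j : 'I_s, (i < j)%N -> P i <> P j,
      irredundant_primary_decomposition (edge_ideal K D)
        (fun i : 'I_s => cover_ideal K D (C i))
    & Ass (edge_ideal K D) = range P].
Proof.
move=> P; have PE i : P i = var_ideal K (C i) by exact: radical_cover_ideal.
have P_inj i j : i != j -> P i <> P j.
  by move=> ij; rewrite !PE => /var_ideal_inj/C_inj/eqP; apply/negP.
have Cs i : strong_vertex_cover D (C i) by apply/C_enum; exists i.
have primC i : primary_ideal (cover_ideal K D (C i)).
  by rewrite cover_power_ideal; apply: power_ideal_primary; apply: cover_exp_gt0.
have IE : edge_ideal K D = \bigcap_(i in [set: 'I_s]) cover_ideal K D (C i).
  rewrite edge_idealE eqEsubset.
  by split=> f fI => [i _|A /C_enum[i <-]]; [apply: fI (Cs i) | exact: (fI i)].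
split=> // [i j ij||].
- by apply: P_inj; rewrite neq_ltn ij.
(* Without the component [i], the intersection would contain the corner monomial of [C i], which
   [I(D)] does not. *)
- split=> // i IEi; apply: (@corner_cover_ideal K _ D (C i)).
  suff : edge_ideal K D 'X_[corner D (C i)] by rewrite IE; apply.
  rewrite IEi => j /= ji; apply: corner_cover_ideal_other => //.
  by move=> /C_inj/eqP; apply/negP.
- rewrite eqEsubset; split=> [Q /(Ass_primary_decomposition primC IE)[i ->]|_ [i _ <-]].
    by exists i.
  (* Conversely, the corner monomial of [C i] has annihilator [P i] modulo [I(D)]. *)
  split; first by rewrite PE; apply: var_ideal_prime.
  by exists 'X_[corner D (C i)]; rewrite PE edge_ideal_colon_corner.
Qed.
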